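(* Suppose that for every $m\ge 2$ and every graph $H$ on $m$ vertices, setting $\ell=|D(H)|/2$, one has $$\lambda_2(H)\ \ge\ \frac{m-\ell+1-\sqrt{(m-\ell+1)^2-4(m-2\ell)}}{2}.$$ Then for every graph $G$ on $n\ge 2$ vertices, $$\max\{\lambda_2(G),\lambda_2(G^c)\}\ \ge\ 2-\sqrt2.$$
   Context: Graphs are finite, simple and undirected; $G^c$ denotes the complement of $G$. The Laplacian of a graph on $n$ vertices is $L=\Delta-A$, where $\Delta$ is the diagonal matrix of degrees and $A$ is the adjacency matrix; its eigenvalues are listed as $0=\lambda_1(G)\le\lambda_2(G)\le\cdots\le\lambda_n(G)$, so $\lambda_2(G)$ (the algebraic connectivity) is the second smallest eigenvalue counted with multiplicity. $d(x,v)$ denotes graph distance (equal to $\infty$ if $x,v$ lie in different components), and $D(G)=\{v\in V(G): \text{there is some } x\in V(G)\text{ with } d(x,v)\ge 3\}$. *)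

(* Defs.v *)
From HB Require Import structures.
From mathcomp Require Import all_boot all_order all_algebra.
From mathcomp Require Import polyrcf.
From mathcomp Require Import reals.

Set Implicit Arguments.
Unset Strict Implicit.
Unset Printing Implicit Defensive.

Import Order.TTheory GRing.Theory Num.Theory.

Local Open Scope ring_scope.

Record sgraph (n : nat) := SGraph {
  adj :> rel 'I_n;
  adj_sym : symmetric adj;
  adj_irr : irreflexive adj }.

Section Graph.
Variables (n : nat) (G : sgraph n).

Let cadj : rel 'I_n := fun x y => (x != y) && ~~ G x y.

Fact cadj_sym : symmetric cadj.
Proof. by move=> x y; rewrite /cadj eq_sym adj_sym. Qed.

Fact cadj_irr : irreflexive cadj.
Proof. by move=> x; rewrite /cadj eqxx. Qed.

Definition gcompl : sgraph n := SGraph cadj_sym cadj_irr.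

Definition degree (x : 'I_n) : nat := #|[set y | G x y]|.

Definition walk (k : nat) (x y : 'I_n) : bool :=
  [exists p : k.-tuple 'I_n, path G x p && (last x p == y)].

Fact connect_walk (x y : 'I_n) : connect G x y -> exists k, walk k x y.
Proof.
case/connectP=> p Gp ->; exists (size p); apply/existsP.
by exists (in_tuple p); rewrite Gp eqxx.
Qed.

(* [None] stands for an infinite distance. *)
Definition dist (x y : 'I_n) : option nat :=
  if @idP (connect G x y) is ReflectT Gxy
  then Some (ex_minn (connect_walk Gxy)) else None.

Definition dist_geq (k : nat) (x y : 'I_n) : bool :=
  if dist x y is Some d then (k <= d)%N else true.

Definition Dset : {set 'I_n} := [set v | [exists x, dist_geq 3 x v]].

End Graph.

Section Spectrum.
Variable R : realType.

Definition adjacency n (G : sgraph n) : 'M[R]_n := \matrix_(i, j) (G i j)%:R.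

Definition laplacian n (G : sgraph n) : 'M[R]_n :=
  diag_mx (\row_i (degree G i)%:R) - adjacency G.

(* [rootsR p] lists the distinct real roots of [p] in increasing order; each is
   repeated according to its multiplicity, so the result is nondecreasing. *)
Definition eigenvalues n (A : 'M[R]_n) : seq R :=
  flatten [seq nseq (mup x (char_poly A)) x | x <- rootsR (char_poly A)].

(* The list is 0-indexed. The default value is never reached when [2 <= n],
   as a real symmetric matrix has [n] real eigenvalues. *)
Definition lambda2 n (G : sgraph n) : R := nth 0 (eigenvalues (laplacian G)) 1.

End Spectrum.

(* Main.v *)
(* If d(x,v) >= 3 in G, then every y is non-adjacent to x or to v, so in the
   complement v is within distance 2 of every vertex through the edge xv. Hence
   D(G) and D(G^c) are disjoint, and one of them, say D(H), has at most n/2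
   elements. The assumed bound is the smaller root of
   q(t) = t^2 - (n-l+1) t + (n-2l). At t = 2 - sqrt 2 we have t^2 = 4t - 2, so q
   is affine in (n,l) there, and nonnegative for l <= n/4 and n >= 4; when n is 2
   or 3 the set D(H) is empty, as D(H) is never a singleton. *)
Require Import Defs.
From HB Require Import structures.
From mathcomp Require Import all_boot all_order all_algebra.
From mathcomp Require Import polyrcf.
From mathcomp Require Import reals.
From mathcomp Require Import zify ring lra.

Set Implicit Arguments.
Unset Strict Implicit.
Unset Printing Implicit Defensive.

Import Order.TTheory GRing.Theory Num.Theory.

Local Open Scope ring_scope.

Section Distance.
Variables (n : nat) (G : sgraph n).
Implicit Types (x y v : 'I_n) (p : seq 'I_n).

Lemma walk_path x p : path G x p -> walk G (size p) x (last x p).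
Proof.
by move=> Gp; apply/existsP; exists (in_tuple p); rewrite Gp eqxx.
Qed.

Lemma walk_sym k x y : walk G k x y -> walk G k y x.
Proof.
case/existsP=> -[p /= /eqP <-] /andP[Gp /eqP <-].
have -> : walk G (size p) (last x p) x = walk G (size (rev (belast x p)))
    (last x p) (last (last x p) (rev (belast x p))).
  rewrite size_rev size_belast; congr walk.
  by case: (p) => //= z s; rewrite rev_cons last_rcons.
apply: walk_path; rewrite rev_path (eq_path (e' := G)) // => u w.
exact: adj_sym.
Qed.

(** In terms of walks, infinite distance needs no separate case later: it just means that there is
    no walk at all. *)
Lemma dist_geqP k x y :
  reflect (forall j, (j < k)%N -> ~~ walk G j x y) (dist_geq G k x y).
Proof.
rewrite /dist_geq /dist; case: {-}_ / idP => [Gxy|nGxy].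
  case: ex_minnP => d Wd min_d; apply: (iffP idP) => [le_kd j lt_jk|noW].
    by apply/negP => /min_d; rewrite leqNgt (leq_trans lt_jk).
  by rewrite leqNgt; apply/negP => /noW; rewrite Wd.
apply: ReflectT => j _; apply/negP => /existsP[p /andP[Gp /eqP defy]].
by apply: nGxy; apply/connectP; exists (tval p).
Qed.

Lemma dist_geq_sym k x y : dist_geq G k x y -> dist_geq G k y x.
Proof.
move=> /dist_geqP noW; apply/dist_geqP => j /noW.
exact/contra/walk_sym.
Qed.

(** A witness [x] for [v] lies in [Dset G] too, by symmetry of the distance, and differs from [v].
    This excludes [d = 1] in the final estimate. *)
Lemma card_Dset_neq1 : #|Dset G| != 1%N.
Proof.
apply/negP => /cards1P[v Dv].
have : v \in Dset G by rewrite Dv set11.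
rewrite inE => /existsP[x gxv].
have : x \in Dset G.
  by rewrite inE; apply/existsP; exists v; apply: dist_geq_sym.
rewrite Dv inE => /eqP xv.
by move/dist_geqP/(_ 0%N isT)/negP: gxv; apply; rewrite xv; apply: (@walk_path v [::]).
Qed.

End Distance.

Section Complement.
Variables (n : nat) (G : sgraph n).
Implicit Types x y v : 'I_n.

Lemma dist_gcompl_lt3 x y v : dist_geq G 3 x v -> ~~ dist_geq (gcompl G) 3 y v.
Proof.
move=> /dist_geqP noW; apply/negP => /dist_geqP noWc.
have nxv : x != v.
  by apply: contraNneq (noW 0%N isT) => ->; apply: (@walk_path n G v [::]).
have nGxv : ~~ G x v.
  by apply: contra (noW 1%N isT) => Gxv; apply: (@walk_path n G x [:: v]); rewrite /= Gxv.
have nyv : y != v.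
  apply: contraNneq (noWc 0%N isT) => ->.
  by apply/existsP; exists [tuple]; rewrite /= eqxx.
(* By [noWc], [y] is a [G]-neighbour of [v], hence not of [x], or else x, y, v would be a walk in
   [G]. So y, x, v is a walk of length 2 in the complement. *)
have Gyv : G y v.
  apply: contraNT (noWc 1%N isT) => nGyv.
  by apply/existsP; exists [tuple v]; rewrite /= nyv nGyv eqxx.
have nyx : y != x by apply: contraNneq nGxv => <-.
have nGyx : ~~ G y x.
  apply: contra (noW 2%N isT) => Gyx.
  by apply: (@walk_path n G x [:: y; v]); rewrite /= adj_sym Gyx Gyv.
case/negP: (noWc 2%N isT).
by apply/existsP; exists [tuple x; v]; rewrite /= nyx nGyx nxv nGxv eqxx.
Qed.

Lemma disjoint_Dset_gcompl : [disjoint Dset G & Dset (gcompl G)].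
Proof.
apply/pred0P => v /=; apply/negbTE/negP => /andP[].
rewrite !inE => /existsP[x gxv] /existsP[y].
exact/negP/(dist_gcompl_lt3 y gxv).
Qed.

End Complement.

(** The difference (b - 2t)^2 - (b^2 - 4c) is 4(t^2 - bt + c), and b - 2t >= 0, so taking square
    roots gives the bound. A negative discriminant is covered: [Num.sqrt] is then 0. *)
Lemma smaller_root_ge (R : rcfType) (b c t : R) :
  2 * t <= b -> 0 <= t ^+ 2 - b * t + c ->
  t <= (b - Num.sqrt (b ^+ 2 - 4 * c)) / 2.
Proof.
move=> tb qt.
suff : Num.sqrt (b ^+ 2 - 4 * c) <= b - 2 * t by lra.
rewrite -[leRHS]ger0_norm; last by lra.
rewrite -sqrtr_sqr ler_wsqrtr //.
by nra.
Qed.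

Lemma two_sub_sqrt2_le (R : rcfType) (m d : nat) :
  (2 <= m)%N -> (2 * d <= m)%N -> d != 1%N ->
  let l : R := d%:R / 2 in
  2 - Num.sqrt 2 <=
    (m%:R - l + 1 - Num.sqrt ((m%:R - l + 1) ^+ 2 - 4 * (m%:R - 2 * l))) / 2.
Proof.
move=> m2 dm d1; cbv zeta.
have : (Num.sqrt 2 : R) ^+ 2 = 2 by rewrite sqr_sqrtr.
have : 0 <= Num.sqrt 2 :> R by apply: sqrtr_ge0.
move: (Num.sqrt 2) => s s0 s2.
have s_ge : 7 / 5 <= s by nra.
have s_le : s <= 3 / 2 by nra.
have m2R : 2 <= m%:R :> R by rewrite ler_nat.
have dmR : 2 * d%:R <= m%:R :> R by rewrite -natrM ler_nat.
apply: smaller_root_ge; first by lra.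
have -> : (2 - s) ^+ 2 - (m%:R - d%:R / 2 + 1) * (2 - s) + (m%:R - 2 * (d%:R / 2))
  = m%:R * (s - 1) - d%:R * s / 2 + 4 - 3 * s :> R by ring: s2.
(* For [d = 0] the expression increases with [m] and equals 2 - s at m = 2. *)
have [d0|d_gt0] := posnP d; first by rewrite d0; nra.
have m4R : 4 <= m%:R :> R by rewrite ler_nat; lia.
(* Four times the goal's right-hand side is (m - 2d)s + (m - 4)(3s - 4), a sum of two nonnegative
   products. *)
have : 0 <= (m%:R - 2 * d%:R) * s by rewrite mulr_ge0 ?subr_ge0.
have s43 : 4 <= 3 * s by nra.
have : 0 <= (m%:R - 4) * (3 * s - 4) by rewrite mulr_ge0 ?subr_ge0.
by lra.
Qed.

Theorem theorem2p3 (R : realType)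
  (hyp : forall (m : nat) (H : sgraph m), (2 <= m)%N ->
     let l : R := #|Dset H|%:R / 2 in
     (m%:R - l + 1 - Num.sqrt ((m%:R - l + 1) ^+ 2 - 4 * (m%:R - 2 * l))) / 2
       <= lambda2 R H) :
  forall (n : nat) (G : sgraph n), (2 <= n)%N ->
    2 - Num.sqrt 2 <= Num.max (lambda2 R G) (lambda2 R (gcompl G)).
Proof.
move=> n G n2.
have small (H : sgraph n) : (2 * #|Dset H| <= n)%N -> 2 - Num.sqrt 2 <= lambda2 R H.
  move=> Dn.
  exact: le_trans (two_sub_sqrt2_le R n2 Dn (card_Dset_neq1 H)) (hyp n H n2).
have cardD : (#|Dset G| + #|Dset (gcompl G)| <= n)%N.
  have := disjoint_Dset_gcompl G; rewrite -leq_card_setU => /eqP <-.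
  by rewrite -[leqRHS]card_ord max_card.
rewrite le_max; case: (leqP (2 * #|Dset G|) n) => [/small -> //|lt_n].
(* Disjointness leaves fewer than n/2 elements for [Dset (gcompl G)]. *)
by rewrite [X in _ || X]small ?orbT //; lia.
Qed.
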